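(* Suppose that $f$ is coercive (i.e. $f(x)\to+\infty$ as $\|x\|\to\infty$) and continuously differentiable, and that the linear operator $\mathcal L$ is bounded. Let $\{(x^k,v^k,\xi^k)\}_{k\in\mathbb N}$ be generated by the LLM-SOF algorithm, or by the LLM-VOS algorithm with $0<\Delta t<1$ (both described in the context). Suppose that there are $\delta_0>0$ and $\eta_{\max}>0$ such that $\xi^k\ge\delta_0$ and $\eta^{k+1}\le\eta_{\max}$ for all $k\ge0$. Case 1 (subsequential convergence): Suppose that, for some $\omega>0$, $\eta^k\ge\frac{\omega}{k}$ for all $k\ge1$. Then there exist a subsequence $\{x^{k_j}\}_{j\ge1}$ and a point $x^*\in\mathbb R^N$ such that $$x^{k_j}\to x^*,\qquad \nabla f(x^{k_j})\to0\quad\text{as }j\to\infty,\qquad\text{and}\qquad \nabla f(x^* )=0.$$ Case 2 (full sequence convergence): Suppose that, for some $\epsilon_0>0$, $\eta^k\ge\epsilon_0$ for all $k\ge1$. Then $$\nabla f(x^k)\to0\quad\text{as }k\to\infty.$$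
   Context: $\mathbb R^N$ carries the standard inner product and norm $\|\cdot\|$. The function $f:\mathbb R^N\to\mathbb R$ has a minimizer. Standing assumption: the pseudo-energy (defined for each algorithm below) is positive everywhere (equivalently $f>0$ everywhere). The damping coefficients satisfy $\eta^k>0$ for all $k\ge1$. In both algorithms, given $z^{k+1}$, the multiplier $\xi^{k+1}$ is computed by the rule (M): if $\|z^{k+1}\|\ne0$, $\xi^{k+1}=\dfrac{-\frac{\mathcal E^k}{\Delta t}+\sqrt{\left(\frac{\mathcal E^k}{\Delta t}\right)^2+4\eta^{k+1}\|z^{k+1}\|^2\frac{\xi^k\mathcal E^{k-1}}{\Delta t}}}{2\eta^{k+1}\|z^{k+1}\|^2}$; otherwise $\xi^{k+1}=\dfrac{\xi^k\mathcal E^{k-1}}{\mathcal E^k}$. LLM-SOF algorithm. Let $\mathcal L$ be a linear positive semidefinite operator on $\mathbb R^N$, $S>0$ a constant, $I$ the identity. Pseudo-energy: $\mathcal E(x,v):=f(x)+\frac12\|v\|^2$, $\mathcal E^k:=\mathcal E(x^k,v^k)$. Inputs: $x^0,v^0\in\mathbb R^N$, $\Delta t>0$, $\xi^0=1$; $x^{-1}=x^0$, $v^{-1}=v^0$. For $k=0,1,2,\dots$: $z^{k+1}=\left(\frac{I}{\Delta t}+S\Delta t\,\mathcal L+\eta^{k+1}I\right)^{-1}\left(\frac{v^k}{\Delta t\,\xi^k}-\nabla f(x^k)\right)$; compute $\xi^{k+1}$ by (M); $v^{k+1}=\xi^{k+1}z^{k+1}$; $x^{k+1}=x^k+\Delta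 t\,\xi^{k+1}z^{k+1}$. LLM-VOS algorithm. Pseudo-energy: $\mathcal E(x,y):=f(x)+\frac12\|y-x\|^2$, $\mathcal E^k:=\mathcal E(x^k,y^k)$. Inputs: $x^0,y^0\in\mathbb R^N$, $\Delta t>0$, $\xi^0=1$; $x^{-1}=x^0$, $y^{-1}=y^0$, $v^0=y^0-x^0$. For $k=0,1,2,\dots$: $z^{k+1}=\frac{1}{\frac1{\Delta t}+\Delta t+(1-\Delta t)\eta^{k+1}}\left(\frac{v^k}{\Delta t}-(1-\Delta t)\nabla f(x^k)\right)$; compute $\xi^{k+1}$ by (M); $y^{k+1}=y^k+\Delta t\left((1-\eta^{k+1})z^{k+1}\xi^{k+1}-\xi^{k+1}\nabla f(x^k)\right)$; $x^{k+1}=x^k+(1-\xi^{k+1})(y^k-x^k)+\Delta t\left(z^{k+1}\xi^{k+1}+y^{k+1}-y^k\right)$; $v^{k+1}=y^{k+1}-x^{k+1}$. *)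

(* Defs.v *)
From HB Require Import structures.
From mathcomp Require Import all_boot all_order all_algebra.
From mathcomp Require Import all_classical all_reals all_analysis.

Set Implicit Arguments.
Unset Strict Implicit.
Unset Printing Implicit Defensive.

Import Order.TTheory GRing.Theory Num.Theory.
Import numFieldNormedType.Exports.

Local Open Scope classical_set_scope.
Local Open Scope ring_scope.

Section Euclidean.
Context {R : realType} {N : nat}.
Implicit Types (u v x : 'rV[R]_N) (f : 'rV[R]_N -> R) (L : 'End('rV[R]_N)).

Definition dotp u v : R := \sum_(i < N) u 0 i * v 0 i.

(* The library norm [`|u|] on matrices is the sup norm; the Euclidean norm is
   needed here. Both induce the topology used for limits and derivatives. *)
Definition enorm u : R := Num.sqrt (dotp u u).

Definition gradient f x : 'rV[R]_N := \row_(i < N) 'D_(delta_mx 0 i) f x.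

Definition continuously_differentiable f : Prop :=
  (forall x, differentiable f x) /\ continuous (gradient f).

Definition coercive f : Prop :=
  forall A : R, exists r : R, forall x, r <= enorm x -> A <= f x.

Definition has_minimizer f : Prop := exists x0, forall x, f x0 <= f x.

(* Symmetry of [L] is deliberately not required. *)
Definition positive_semidefinite L : Prop := forall u, 0 <= dotp (L u) u.

Definition bounded_operator L : Prop :=
  exists C : R, forall u, enorm (L u) <= C * enorm u.

End Euclidean.

Section Algorithms.
Context {R : realType} {N : nat}.
Implicit Types (f : 'rV[R]_N -> R) (dt : R) (eta xi : nat -> R).

(* [llm_multiplier dt eta z xi E0 E1] is xi^{k+1} computed from
   eta = eta^{k+1}, z = z^{k+1}, xi = xi^k, E0 = E^{k-1} and E1 = E^k. *)
Definition llm_multiplier dt (eta : R) (z : 'rV[R]_N) (xi E0 E1 : R) : R :=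
  if enorm z != 0 then
    (- (E1 / dt) + Num.sqrt ((E1 / dt) ^+ 2
                             + 4 * eta * enorm z ^+ 2 * (xi * E0 / dt)))
    / (2 * eta * enorm z ^+ 2)
  else xi * E0 / E1.

Definition sof_energy f (x v : 'rV[R]_N) : R := f x + 2^-1 * enorm v ^+ 2.

Definition sof_operator (L : 'End('rV[R]_N)) (S dt eta : R) :
    'End('rV[R]_N) :=
  dt^-1 *: \1%VF + (S * dt) *: L + eta *: \1%VF.

Definition sof_direction f L S dt (eta xi : R) (x v : 'rV[R]_N) : 'rV[R]_N :=
  ((sof_operator L S dt eta)^-1)%VF ((dt * xi)^-1 *: v - gradient f x).

(* The conventions x^{-1} = x^0 and v^{-1} = v^0 are rendered by the
   predecessor on [nat], for which [0.-1 = 0]; so E^{-1} = E^0. The entry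
   [eta 0] is never used. *)
Definition LLM_SOF f (L : 'End('rV[R]_N)) (S dt : R) eta
    (x v : nat -> 'rV[R]_N) xi : Prop :=
  let E k := sof_energy f (x k) (v k) in
  xi 0%N = 1 /\
  forall k : nat,
    let z := sof_direction f L S dt (eta k.+1) (xi k) (x k) (v k) in
    [/\ xi k.+1 = llm_multiplier dt (eta k.+1) z (xi k) (E k.-1) (E k),
        v k.+1 = xi k.+1 *: z
      & x k.+1 = x k + (dt * xi k.+1) *: z].

Definition vos_energy f (x y : 'rV[R]_N) : R := f x + 2^-1 * enorm (y - x) ^+ 2.

Definition vos_direction f dt (eta : R) (x v : 'rV[R]_N) : 'rV[R]_N :=
  (dt^-1 + dt + (1 - dt) * eta)^-1 *:
    (dt^-1 *: v - (1 - dt) *: gradient f x).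

Definition LLM_VOS f dt eta (x y v : nat -> 'rV[R]_N) xi : Prop :=
  let E k := vos_energy f (x k) (y k) in
  [/\ xi 0%N = 1,
      v 0%N = y 0%N - x 0%N
    & forall k : nat,
      let z := vos_direction f dt (eta k.+1) (x k) (v k) in
      [/\ xi k.+1 = llm_multiplier dt (eta k.+1) z (xi k) (E k.-1) (E k),
          y k.+1 = y k + dt *: (((1 - eta k.+1) * xi k.+1) *: z
                                - xi k.+1 *: gradient f (x k)),
          x k.+1 = x k + (1 - xi k.+1) *: (y k - x k)
                   + dt *: (xi k.+1 *: z + y k.+1 - y k)
        & v k.+1 = y k.+1 - x k.+1]].

End Algorithms.

(* Main.v *)
Require Import Defs.
From mathcomp Require Import all_boot all_order all_algebra.
From mathcomp Require Import all_classical all_reals all_analysis.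
From mathcomp Require Import ring lra zify.

Import Order.TTheory GRing.Theory Num.Theory.
Import numFieldNormedType.Exports.

Local Open Scope classical_set_scope.
Local Open Scope ring_scope.

(** Both algorithms are instances of one scheme. The multiplier rule picks the
    positive root [xi'] of

      [eta * |z|^2 * xi'^2 + (E1 / dt) * xi' - xi * E0 / dt = 0],

    and in both algorithms the new velocity is [v' = xi' * z] (by definition
    for LLM-SOF, by an algebraic cancellation, [vos_velocity], for LLM-VOS).
    So the root equation is a dissipation law
    ([multiplier_dissipation]): the modified energy [r_k = xi_k * E_(k-1)]
    drops at each step by exactly [dt * eta_(k+1) * |v_(k+1)|^2]. As [r] stays
    nonnegative, [sum eta_(k+1) * |v_(k+1)|^2] is finite; as [xi >= delta0],
    the energies [E_k] and hence the values [f (x_k)] are bounded, so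
    coercivity keeps the iterates in a bounded set
    ([energy_dissipating_bounds]).

    Solving the equation that defines [z_(k+1)] for the gradient, and using
    [xi >= delta0], [eta <= eta_max] and the boundedness of [L], bounds
    [grad f (x_k)] by a multiple of [|v_k| + |v_(k+1)|]
    ([sof_gradient_controlled], [vos_gradient_controlled]). It remains to make
    two consecutive velocities small.

    If [eta >= eps0], then [sum |v_k|^2] is finite and [v] tends to 0
    ([gradient_cvg0]). If only [eta_k >= omega / k], then [sum |v_k|^2 / k] is
    finite; since the harmonic series diverges, two consecutive velocities are
    simultaneously small infinitely often
    ([harmonic_sum_consecutive_small]). This gives a subsequence along which
    the gradient tends to 0, and Bolzano-Weierstrass with the continuity of
    the gradient gives the critical point [xstar]
    ([gradient_cvg0_subsequence]).

    Energies are measured with the Euclidean norm. Gradients are estimated in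
    the sup norm of row vectors, which carries the topology and is dominated by
    the Euclidean one ([le_norm_enorm]). *)

(** * The Euclidean norm *)

Lemma dotpDl {R : realType} {N : nat} (u v w : 'rV[R]_N) :
  dotp (u + v) w = dotp u w + dotp v w.
Proof.
by rewrite /dotp -big_split; apply: eq_bigr => i _; rewrite mxE mulrDl.
Qed.

Lemma dotpZl {R : realType} {N : nat} (a : R) (u w : 'rV[R]_N) :
  dotp (a *: u) w = a * dotp u w.
Proof.
by rewrite /dotp mulr_sumr; apply: eq_bigr => i _; rewrite mxE mulrA.
Qed.

Lemma dotpZr {R : realType} {N : nat} (a : R) (u w : 'rV[R]_N) :
  dotp u (a *: w) = a * dotp u w.
Proof.
by rewrite /dotp mulr_sumr; apply: eq_bigr => i _; rewrite mxE mulrCA.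
Qed.

Lemma dotp_ge0 {R : realType} {N : nat} (u : 'rV[R]_N) : 0 <= dotp u u.
Proof. by apply: sumr_ge0 => i _; rewrite -expr2 sqr_ge0. Qed.

Lemma enorm_ge0 {R : realType} {N : nat} (u : 'rV[R]_N) : 0 <= enorm u.
Proof. exact: sqrtr_ge0. Qed.

Lemma sqr_enorm {R : realType} {N : nat} (u : 'rV[R]_N) :
  enorm u ^+ 2 = dotp u u.
Proof. exact/sqr_sqrtr/dotp_ge0. Qed.

Lemma enormZ {R : realType} {N : nat} (a : R) (u : 'rV[R]_N) :
  enorm (a *: u) = `|a| * enorm u.
Proof.
by rewrite /enorm dotpZl dotpZr mulrA -expr2 sqrtrM ?sqr_ge0// sqrtr_sqr.
Qed.

Lemma le_norm_enorm {R : realType} {N : nat} (u : 'rV[R]_N) :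
  `|u| <= enorm u.
Proof.
rewrite [`|u|]mx_normrE; apply/bigmax_leP; split=> [|[i j] _ /=].
  exact: enorm_ge0.
rewrite -sqrtr_sqr ler_sqrt ?dotp_ge0// ord1 /dotp (bigD1 j)//= -expr2 lerDl.
by apply: sumr_ge0 => k _; rewrite -expr2 sqr_ge0.
Qed.

Lemma enorm_eq0 {R : realType} {N : nat} (u : 'rV[R]_N) :
  enorm u = 0 -> u = 0.
Proof.
by move=> u0; apply/eqP; rewrite -normr_eq0 eq_le normr_ge0 -u0 le_norm_enorm.
Qed.

Lemma dotp_le0 {R : realType} {N : nat} (u : 'rV[R]_N) :
  dotp u u <= 0 -> u = 0.
Proof.
by move=> u0; apply: enorm_eq0; rewrite /enorm ler0_sqrtr.
Qed.

(** * Subsequences *)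

(** Diagonal extraction: recurrent properties can be realised one after the
    other along a single subsequence. It is used with [P j k] saying that the
    [k]-th term is within [1 / (j + 1)] of the prospective limit. *)
Lemma increasing_choice (P : nat -> nat -> Prop) :
  (forall j n, exists2 k, (n <= k)%N & P j k) ->
  exists2 s : nat -> nat,
    {homo s : i j / (i < j)%N >-> (i < j)%N} & forall j, P j (s j).
Proof.
move=> H.
have /choice[g gP] : forall jn : nat * nat,
    exists k, (jn.2 <= k)%N /\ P jn.1 k.
  by move=> [j n]; have [k] := H j n; exists k.
pose s := fix s j := if j is i.+1 then g (j, (s i).+1) else g (0, 0)%N.
exists s; last by case=> [|j]; [exact: (gP (0, 0)%N).2|exact: (gP (_, _)).2].
apply: homo_ltn => [|i]; first exact: ltn_trans.
exact: (gP (i.+1, (s i).+1)).1.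
Qed.

Lemma cvg_natSinv_bound {R : realType} {V : normedModType R}
    (u : nat -> V) (l : V) :
  (forall j, `|l - u j| < j.+1%:R^-1) -> u j @[j --> \oo] --> l.
Proof.
move=> ul; apply/cvgrPdist_lt => e e0; near=> j.
apply: lt_trans (ul j) _; near: j.
exact: (near_infty_natSinv_lt (PosNum e0)).
Unshelve. all: by end_near. Qed.

(** Bolzano-Weierstrass in finite dimension: by compactness of the closed ball
    the sequence has a cluster point, approached along an extracted
    subsequence. *)
Lemma bounded_cvg_subsequence {R : realType} {N : nat}
    (u : nat -> 'rV[R]_N) (B : R) :
  (forall k, `|u k| <= B) ->
  exists (s : nat -> nat) (l : 'rV[R]_N),
    {homo s : i j / (i < j)%N >-> (i < j)%N} /\ u (s j) @[j --> \oo] --> l.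
Proof.
move=> uB.
have cB : compact (closed_ball_ Num.norm (0 : 'rV[R]_N) B).
  apply: bounded_closed_compact; last exact: closed_closed_ball_.
  exists B; split; first exact: num_real.
  by move=> M BM y; rewrite /closed_ball_/= sub0r normrN => /le_trans; apply;
    exact: ltW.
have [|l [_ lu]] := cB (u x @[x --> \oo]) (fmap_proper_filter _ _).
  by exists 0%N => // k _ /=; rewrite /closed_ball_/= sub0r normrN.
have [|s s_incr su] := @increasing_choice
    (fun j k => `|l - u k| < j.+1%:R^-1).
  move=> j n.
  have j0 : 0 < j.+1%:R^-1 :> R by rewrite invr_gt0.
  have [||_ [[k /= nk <-]]] := lu [set u k | k in [set k | (n <= k)%N]]
    (ball l j.+1%:R^-1).
  - by exists n => // k /= nk; exists k.
  - exact: nbhsx_ballx.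
  - by rewrite -ball_normE /=; exists k.
by exists s, l; split => //; exact: cvg_natSinv_bound.
Qed.

(** * Series *)

Lemma bounded_series_cvg {R : realType} (u : nat -> R) (C : R) :
  (forall k, 0 <= u k) -> (forall n, \sum_(0 <= k < n) u k <= C) ->
  cvgn (series u).
Proof.
move=> u0 uC; apply: nondecreasing_is_cvgn.
  by apply: nondecreasing_series => n _ _; exact: u0.
by exists C => _ [n _ <-]; exact: uC.
Qed.

(** If for every [k] beyond [n] one of [g k], [g k.+1] were at least [e], then
    [g k / (k + 1) + 2 * (g k.+1 / (k + 2))] would dominate [e / (k + 1)] from
    [n] on, and the harmonic series would have bounded partial sums. *)
Lemma harmonic_sum_consecutive_small {R : realType} (g : nat -> R) (C : R) :
  (forall k, 0 <= g k) ->
  (forall n, \sum_(0 <= k < n) g k / k.+1%:R <= C) ->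
  forall (e : R) (n : nat), 0 < e ->
  exists2 k, (n <= k)%N & g k < e /\ g k.+1 < e.
Proof.
move=> g0 gC e n e0; apply: contrapT => nex.
apply: (@dvg_harmonic R).
apply: (@bounded_series_cvg _ _ (n%:R + e^-1 * (C + 2 * C))) => [k|m].
  exact: harmonic_ge0.
(* The summand [(k < n)] absorbs the first [n] terms, and the factor 2 comes
   from [k + 2 <= 2 * (k + 1)]. *)
have le_k k : harmonic k <=
    (k < n)%:R + e^-1 * (g k / k.+1%:R + 2 * (g k.+1 / k.+2%:R)) :> R.
  have p1 : 0 < k.+1%:R :> R by [].
  have p2 : 0 < k.+2%:R :> R by [].
  have q1 : 0 <= e^-1 by rewrite invr_ge0 ltW.
  have q2 : 0 <= g k / k.+1%:R by rewrite divr_ge0.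
  have q3 : 0 <= g k.+1 / k.+2%:R by rewrite divr_ge0.
  rewrite /harmonic /=; have [kn|nk] := ltnP k n.
    apply: (@le_trans _ _ 1); first by rewrite invf_le1 ?ler1n.
    by rewrite lerDl mulr_ge0// addr_ge0// mulr_ge0.
  rewrite add0r ler_pdivlMl//.
  have [ge|lt] := leP e (g k).
    apply: (@le_trans _ _ (g k / k.+1%:R)); first by rewrite ler_pM2r ?invr_gt0.
    by rewrite lerDl mulr_ge0.
  have ge : e <= g k.+1.
    by rewrite leNgt; apply/negP => lt'; apply: nex; exists k.
  apply: (@le_trans _ _ (2 * (g k.+1 / k.+2%:R))); last by rewrite lerDr.
  apply: (@le_trans _ _ (2 * (e / k.+2%:R))); last first.
    by rewrite ler_pM2l// ler_pM2r ?invr_gt0.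
  rewrite mulrCA ler_pM2l// ler_pdivlMr// mulrC ler_pdivrMr//.
  by rewrite -natrM ler_nat; lia.
apply: le_trans (ler_sum _ (fun k _ => le_k k)) _.
rewrite big_split/= -mulr_sumr big_split/= -mulr_sumr; apply: lerD.
  suff -> : \sum_(0 <= k < m) (k < n)%:R = (minn m n)%:R :> R.
    by rewrite ler_nat geq_minr.
  elim: m => [|m IHm]; first by rewrite big_geq// min0n.
  rewrite big_nat_recr//= IHm -natrD; congr (_%:R).
  by have [mn|nm] := ltnP m n; lia.
have g1 : \sum_(0 <= k < m) g k.+1 / k.+2%:R <= C.
  apply: le_trans (gC m.+1); rewrite big_nat_recl// lerDr.
  by rewrite divr_ge0.
by rewrite ler_pM2l ?invr_gt0// lerD// ler_pM2l.
Qed.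

(** * Energy dissipation *)

(** This is the equation of which the multiplier is a root, multiplied by [dt];
    the degenerate rule for [z = 0] is the same equation without its quadratic
    term. *)
Lemma multiplier_dissipation {R : realType} {N : nat} {dt eta : R}
    {z : 'rV[R]_N} {xi E0 E1 : R} :
  0 < dt -> 0 < eta -> 0 <= xi * E0 -> 0 < E1 ->
  let xi' := llm_multiplier dt eta z xi E0 E1 in
  xi' * E1 = xi * E0 - dt * (eta * enorm (xi' *: z) ^+ 2).
Proof.
move=> dt0 eta0 xiE0 E1_gt0 /=; rewrite enormZ exprMn real_normK ?num_real//.
rewrite /llm_multiplier; case: ifPn => [z0|]; last first.
  by rewrite negbK => /eqP ->; rewrite expr0n !mulr0 subr0 divfK// gt_eqF.
have : 0 <= (E1 / dt) ^+ 2 + 4 * eta * enorm z ^+ 2 * (xi * E0 / dt).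
  rewrite addr_ge0 ?sqr_ge0//; apply: mulr_ge0; last by rewrite divr_ge0// ltW.
  by rewrite mulr_ge0 ?sqr_ge0// mulr_ge0// ltW.
move=> /sqr_sqrtr; move: (Num.sqrt _ : R) => r rE.
have dtE : dt != 0 by rewrite gt_eqF.
have etaE : eta != 0 by rewrite gt_eqF.
set q := (_ / _).
(* Clearing the square root in favour of [q] turns the quadratic formula back
   into [eta * |z|^2 * q^2 + (E1 / dt) * q = xi * E0 / dt]. *)
have rq : r = 2 * eta * enorm z ^+ 2 * q + E1 / dt.
  by rewrite /q; field; rewrite z0 dtE etaE.
move: rE; rewrite rq => rE.
have a0 : 4 * eta * enorm z ^+ 2 / dt != 0.
  by rewrite !mulf_neq0 ?invr_eq0 ?expf_neq0// pnatr_eq0.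
apply: (mulfI a0); apply/eqP; rewrite -subr_eq0.
have := rE; move/eqP; rewrite -subr_eq0 => /eqP <-; apply/eqP.
by field.
Qed.

Lemma dissipation_sum_le {R : realType} (r d : nat -> R) :
  (forall k, 0 <= r k) -> (forall k, r k.+1 = r k - d k) ->
  forall n, \sum_(0 <= k < n) d k <= r 0%N.
Proof.
move=> r0 rd n; suff -> : \sum_(0 <= k < n) d k = r 0%N - r n.
  by rewrite gerBl.
elim: n => [|n IHn]; first by rewrite big_geq// subrr.
by rewrite big_nat_recr//= IHn rd; ring.
Qed.

(** The part common to both algorithms of what the multiplier rule yields. The
    energies are abstract, for the two pseudo-energies have different second
    arguments; only the dissipation law and the bound on [f] matter later.
    Since [0.-1 = 0], the energy before the start is the initial one. *)
Definition energy_dissipating {R : realType} {N : nat} (dt : R)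
    (f : 'rV[R]_N -> R) (eta xi : nat -> R) (x v : nat -> 'rV[R]_N) : Prop :=
  exists E : nat -> R,
    [/\ forall k, 0 < E k, forall k, f (x k) <= E k &
      forall k, xi k.+1 * E k
        = xi k * E k.-1 - dt * (eta k.+1 * enorm (v k.+1) ^+ 2)].

(** Two consecutive small velocities force a small gradient: this is all that
    the convergence proof uses of the equation for the direction. *)
Definition gradient_controlled {R : realType} {N : nat}
    (f : 'rV[R]_N -> R) (x v : nat -> 'rV[R]_N) : Prop :=
  exists2 M : R, 0 < M &
    forall k, `|gradient f (x k)| <= M * (enorm (v k) + enorm (v k.+1)).

(** The modified energy [xi k * E k.-1] is nonincreasing from [E 0]; dividing by
    the lower bound on [xi] recovers a bound on the energy itself. *)
Lemma energy_le_initial {R : realType} {delta0 : R} {E xi d : nat -> R} :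
  0 < delta0 -> xi 0%N = 1 -> (forall k, delta0 <= xi k) ->
  (forall k, 0 < E k) -> (forall k, 0 <= d k) ->
  (forall k, xi k.+1 * E k = xi k * E k.-1 - d k) ->
  (forall k, E k <= E 0%N / delta0) /\
  (forall n, \sum_(0 <= k < n) d k <= E 0%N).
Proof.
move=> delta0_gt0 xi0 xi_ge E_gt0 d_ge0 diss.
have xi_ge0 k : 0 <= xi k by rewrite (le_trans _ (xi_ge k))// ltW.
pose r k := xi k * E k.-1.
have r0 : r 0%N = E 0%N by rewrite /r xi0 mul1r.
have r_ge0 k : 0 <= r k by rewrite /r mulr_ge0// ltW.
have rd k : r k.+1 = r k - d k by rewrite /r diss.
split=> [k|n]; last by rewrite -r0; exact: dissipation_sum_le.
have r_le m : r m <= r 0%N.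
  by elim: m => // m; apply: le_trans; rewrite rd gerBl.
rewrite ler_pdivlMr// mulrC -r0 (le_trans _ (r_le k.+1))// /r ler_wpM2r//.
exact: ltW.
Qed.

(** * The two algorithms *)

(** The operator is strictly coercive: its quadratic form is at least
    [(1 / dt + eta) * |u|^2]. Injectivity is what makes the linear-map inverse
    in the definition of the direction a genuine inverse. *)
Lemma sof_operator_inj {R : realType} {N : nat} {L : 'End('rV[R]_N)}
    {S dt eta : R} :
  positive_semidefinite L -> 0 < S -> 0 < dt -> 0 < eta ->
  lker (sof_operator L S dt eta) == 0%VS.
Proof.
move=> Lpsd S0 dt0 eta0; apply/lker0P => a b ab; apply/eqP; rewrite -subr_eq0.
have : sof_operator L S dt eta (a - b) = 0 by rewrite linearB/= ab subrr.
move: (a - b : 'rV[R]_N) => u.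
rewrite /sof_operator !add_lfunE !scale_lfunE !id_lfunE => Au0.
apply/eqP/dotp_le0.
have := congr1 (fun w => dotp w u) Au0; rewrite /= !dotpDl !dotpZl.
have -> : dotp 0 u = 0.
  by rewrite -(scale0r u) dotpZl mul0r.
have H1 : 0 <= S * dt * dotp (L u) u by rewrite !mulr_ge0// ltW.
have H2 : 0 < dt^-1 + eta by rewrite addr_gt0// invr_gt0.
move=> H; rewrite -(pmulr_rle0 _ H2) mulrDl; lra.
Qed.

Lemma sof_energy_dissipating {R : realType} {N : nat} {f : 'rV[R]_N -> R}
    {L : 'End('rV[R]_N)} {S dt : R} {eta xi : nat -> R}
    {x v : nat -> 'rV[R]_N} :
  0 < dt -> (forall k, (1 <= k)%N -> 0 < eta k) -> (forall k, 0 <= xi k) ->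
  (forall a b, 0 < sof_energy f a b) -> LLM_SOF f L S dt eta x v xi ->
  energy_dissipating dt f eta xi x v.
Proof.
move=> dt0 eta0 xi_ge0 E_gt0 [_ step].
exists (fun k => sof_energy f (x k) (v k)); split=> // k.
  by rewrite lerDl mulr_ge0 ?sqr_ge0// invr_ge0.
have [xiS -> _] := step k; rewrite {1}xiS multiplier_dissipation -?xiS//.
- exact: eta0.
- by rewrite mulr_ge0// ltW.
Qed.

(** The direction [z] satisfies [A z = v / (dt * xi) - grad f x], where [|A z|]
    is at most [(1 / dt + S * dt * |C| + eta_max) * |z|], and
    [|z| <= |v'| / delta0] because [v' = xi' * z]. *)
Lemma sof_gradient_controlled {R : realType} {N : nat} {f : 'rV[R]_N -> R}
    {L : 'End('rV[R]_N)} {S dt delta0 eta_max : R} {eta xi : nat -> R}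
    {x v : nat -> 'rV[R]_N} :
  positive_semidefinite L -> bounded_operator L -> 0 < S -> 0 < dt ->
  0 < delta0 -> 0 < eta_max -> (forall k, (1 <= k)%N -> 0 < eta k) ->
  (forall k, delta0 <= xi k) -> (forall k, eta k.+1 <= eta_max) ->
  LLM_SOF f L S dt eta x v xi -> gradient_controlled f x v.
Proof.
move=> Lpsd [C LC] S0 dt0 delta0_gt0 etam0 eta0 xi_ge eta_le [_ step].
have xi_gt0 k : 0 < xi k by exact: lt_le_trans (xi_ge k).
pose M := dt^-1 + S * dt * `|C| + eta_max.
have M0 : 0 < M.
  by rewrite addr_gt0// ltr_wpDr ?invr_gt0// !mulr_ge0// ltW.
exists ((dt * delta0)^-1 + M / delta0) => [|k].
  by rewrite addr_gt0 ?divr_gt0// invr_gt0 mulr_gt0.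
have [_ vS _] := step k; move: vS.
set z := sof_direction _ _ _ _ _ _ _ _ => vS.
have zS : (dt * xi k)^-1 *: v k - gradient f (x k)
    = sof_operator L S dt (eta k.+1) z.
  by rewrite /z /sof_direction lker0_lfunVK//; exact/sof_operator_inj/eta0.
have -> : gradient f (x k)
    = (dt * xi k)^-1 *: v k - sof_operator L S dt (eta k.+1) z.
  by rewrite -zS opprB addrC subrK.
have zle : enorm z <= enorm (v k.+1) / delta0.
  rewrite ler_pdivlMr// vS enormZ gtr0_norm// mulrC.
  by rewrite ler_wpM2r ?enorm_ge0.
have Az : `|sof_operator L S dt (eta k.+1) z| <= M * enorm z.
  rewrite /sof_operator !add_lfunE !scale_lfunE !id_lfunE /M !mulrDl.
  apply: (le_trans (ler_normD _ _)); apply: lerD; last first.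
    rewrite normrZ gtr0_norm; last exact: eta0.
    by rewrite ler_pM ?le_norm_enorm// ltW// eta0.
  apply: (le_trans (ler_normD _ _)); apply: lerD.
    by rewrite normrZ gtr0_norm ?invr_gt0// ler_pM2l ?invr_gt0// le_norm_enorm.
  have Sdt : 0 < S * dt by exact: mulr_gt0.
  rewrite normrZ gtr0_norm// -(mulrA (S * dt)) ler_pM2l//.
  apply: le_trans (le_norm_enorm _) _; apply: le_trans (LC z) _.
  by rewrite ler_wpM2r ?enorm_ge0// ler_norm.
have vle : `|(dt * xi k)^-1 *: v k| <= (dt * delta0)^-1 * enorm (v k).
  have dx : 0 < dt * xi k by exact: mulr_gt0.
  rewrite normrZ gtr0_norm ?invr_gt0//.
  apply: ler_pM; rewrite ?le_norm_enorm ?normr_ge0 ?invr_ge0 ?(ltW dx)//.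
  by rewrite ler_pV2 ?inE ?unitfE ?gt_eqF ?mulr_gt0// ler_pM2l.
apply: le_trans (ler_normB _ _) _.
apply: le_trans (lerD vle (le_trans Az (ler_wpM2l (ltW M0) zle))) _.
have n0 := enorm_ge0 (v k); have n1 := enorm_ge0 (v k.+1).
have p0 : 0 <= (dt * delta0)^-1 by rewrite invr_ge0 mulr_ge0// ltW.
have p1 : 0 <= M / delta0 by rewrite divr_ge0// ltW.
have -> : M * (enorm (v k.+1) / delta0) = M / delta0 * enorm (v k.+1).
  by rewrite mulrCA mulrC.
move: (M / delta0) p1 => B p1; rewrite mulrDr !mulrDl -addrA lerD2l addrA lerDr.
by rewrite addr_ge0// mulr_ge0.
Qed.

(** Substituting the updates of [x] and [y] in [v' = y' - x'] gives
    [xi' * (v - dt * (1 - dt) * grad f x + c * z)] for some coefficient [c];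
    eliminating the gradient with the equation for [z] cancels [v] and leaves
    the coefficient 1 on [z]. *)
Lemma vos_velocity {R : realType} {N : nat} {f : 'rV[R]_N -> R}
    {dt : R} {eta xi : nat -> R} {x y v : nat -> 'rV[R]_N} :
  0 < dt < 1 -> (forall k, (1 <= k)%N -> 0 < eta k) ->
  LLM_VOS f dt eta x y v xi ->
  forall k, v k.+1
    = xi k.+1 *: vos_direction f dt (eta k.+1) (x k) (v k).
Proof.
move=> /andP[dt0 dt1] eta0 [_ v0 step] k.
have vE : v k = y k - x k by case: k => [//|k]; case: (step k).
have [_ yS xS ->] := step k; move: yS xS.
set z := vos_direction _ _ _ _ _.
have D0 : 0 < dt^-1 + dt + (1 - dt) * eta k.+1.
  by rewrite !addr_gt0// ?invr_gt0// mulr_gt0 ?eta0// subr_gt0.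
have : (dt^-1 + dt + (1 - dt) * eta k.+1) *: z
    = dt^-1 *: v k - (1 - dt) *: gradient f (x k).
  by rewrite /z scalerA mulfV ?scale1r// gt_eqF.
rewrite vE; move: z (gradient _ _) => z g zE yS xS; rewrite xS yS.
apply/rowP => i; have := congr1 (fun w : 'rV[R]_N => w 0 i) zE.
rewrite !mxE; move: (z 0 i) (g 0 i) (x k 0 i) (y k 0 i) => z' g' a b H.
(* The equation for [z], multiplied by [dt] to clear the inverse. *)
have H' : (1 + dt ^+ 2 + dt * (1 - dt) * eta k.+1) * z'
    = (b - a) - dt * (1 - dt) * g'.
  transitivity (dt * ((dt^-1 + dt + (1 - dt) * eta k.+1) * z')).
    by field; rewrite gt_eqF.
  by rewrite H; field; rewrite gt_eqF.
have {}H' : b - a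
    = (1 + dt ^+ 2 + dt * (1 - dt) * eta k.+1) * z' + dt * (1 - dt) * g'.
  by rewrite H' subrK.
(* Eliminating [b], that is the velocity, leaves an identity in the gradient
   [g'] and the direction [z']. *)
have -> : b = a
    + ((1 + dt ^+ 2 + dt * (1 - dt) * eta k.+1) * z' + dt * (1 - dt) * g').
  by rewrite -H' addrC subrK.
by ring.
Qed.

Lemma vos_energy_dissipating {R : realType} {N : nat} {f : 'rV[R]_N -> R}
    {dt : R} {eta xi : nat -> R} {x y v : nat -> 'rV[R]_N} :
  0 < dt < 1 -> (forall k, (1 <= k)%N -> 0 < eta k) -> (forall k, 0 <= xi k) ->
  (forall a b, 0 < vos_energy f a b) -> LLM_VOS f dt eta x y v xi ->
  energy_dissipating dt f eta xi x v.
Proof.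
move=> dt01 eta0 xi_ge0 E_gt0 vos.
have vS := vos_velocity dt01 eta0 vos; have [_ _ step] := vos.
have /andP[dt0 _] := dt01.
exists (fun k => vos_energy f (x k) (y k)); split=> // k.
  by rewrite lerDl mulr_ge0 ?sqr_ge0// invr_ge0.
have [xiS _ _ _] := step k; rewrite vS {1}xiS multiplier_dissipation -?xiS//.
- exact: eta0.
- by rewrite mulr_ge0// ltW.
Qed.

(** As for LLM-SOF, from [(1 - dt) * grad f x = v / dt - D * z], with [D] the
    denominator in the direction; [dt < 1] allows dividing by [1 - dt]. *)
Lemma vos_gradient_controlled {R : realType} {N : nat} {f : 'rV[R]_N -> R}
    {dt delta0 eta_max : R} {eta xi : nat -> R}
    {x y v : nat -> 'rV[R]_N} :
  0 < dt < 1 -> 0 < delta0 -> 0 < eta_max ->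
  (forall k, (1 <= k)%N -> 0 < eta k) ->
  (forall k, delta0 <= xi k) -> (forall k, eta k.+1 <= eta_max) ->
  LLM_VOS f dt eta x y v xi -> gradient_controlled f x v.
Proof.
move=> dt01 delta0_gt0 etam0 eta0 xi_ge eta_le vos.
have /andP[dt0 dt1] := dt01.
have xi_gt0 k : 0 < xi k by exact: lt_le_trans (xi_ge k).
have c0 : 0 < 1 - dt by rewrite subr_gt0.
pose M := dt^-1 + dt + (1 - dt) * eta_max.
have M0 : 0 < M by rewrite !addr_gt0// ?invr_gt0// mulr_gt0.
exists ((dt^-1 + M / delta0) / (1 - dt)) => [|k].
  by rewrite divr_gt0// addr_gt0 ?divr_gt0// invr_gt0.
have := vos_velocity dt01 eta0 vos k.
set z := vos_direction _ _ _ _ _ => vS.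
pose D := dt^-1 + dt + (1 - dt) * eta k.+1.
have D0 : 0 < D by rewrite !addr_gt0// ?invr_gt0// mulr_gt0 ?eta0.
have zE : (1 - dt) *: gradient f (x k) = dt^-1 *: v k - D *: z.
  by rewrite /z scalerA mulfV ?scale1r ?gt_eqF// opprB addrCA subrr addr0.
move: z vS zE => z vS zE.
have zle : enorm z <= enorm (v k.+1) / delta0.
  rewrite ler_pdivlMr// vS enormZ gtr0_norm// mulrC.
  by rewrite ler_wpM2r ?enorm_ge0.
rewrite mulrAC ler_pdivlMr// mulrC -[X in X * _]gtr0_norm// -normrZ zE.
apply: le_trans (ler_normB _ _) _; rewrite !normrZ !gtr0_norm ?invr_gt0//.
have Dz : D * `|z| <= M * (enorm (v k.+1) / delta0).
  rewrite ler_pM ?(ltW D0) ?(le_trans (le_norm_enorm _) zle)//.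
  by rewrite lerD2l ler_pM2l.
apply: le_trans (lerD (ler_wpM2l _ (le_norm_enorm _)) Dz) _.
  by rewrite invr_ge0 ltW.
have n0 := enorm_ge0 (v k); have n1 := enorm_ge0 (v k.+1).
have p0 : 0 <= dt^-1 by rewrite invr_ge0 ltW.
have p1 : 0 <= M / delta0 by rewrite divr_ge0// ltW.
have -> : M * (enorm (v k.+1) / delta0) = M / delta0 * enorm (v k.+1).
  by rewrite mulrCA mulrC.
move: (M / delta0) p1 => B p1; rewrite mulrDr !mulrDl -addrA lerD2l addrA lerDr.
by rewrite addr_ge0// mulr_ge0.
Qed.

(** * Convergence of the gradients *)

Lemma coercive_sublevel_bounded {R : realType} {N : nat}
    (f : 'rV[R]_N -> R) (A : R) :
  coercive f -> exists B, forall a, f a <= A -> `|a| <= B.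
Proof.
move=> /(_ (A + 1))[B fB]; exists B => a faA.
apply: le_trans (le_norm_enorm a) _; rewrite leNgt; apply/negP => /ltW/fB.
by move/le_trans => /(_ _ faA); rewrite gerDl ler10.
Qed.

Lemma energy_dissipating_bounds {R : realType} {N : nat} {dt delta0 : R}
    {f : 'rV[R]_N -> R} {eta xi : nat -> R} {x v : nat -> 'rV[R]_N} :
  coercive f -> 0 < dt -> 0 < delta0 ->
  (forall k, (1 <= k)%N -> 0 < eta k) -> xi 0%N = 1 ->
  (forall k, delta0 <= xi k) -> energy_dissipating dt f eta xi x v ->
  (exists B, forall k, `|x k| <= B) /\
  (exists C, forall n, \sum_(0 <= k < n) eta k.+1 * enorm (v k.+1) ^+ 2 <= C).
Proof.
move=> f_coer dt0 delta0_gt0 eta0 xi0 xi_ge [E [E0 fE diss]].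
have d0 k : 0 <= dt * (eta k.+1 * enorm (v k.+1) ^+ 2).
  by rewrite mulr_ge0 ?(ltW dt0)// mulr_ge0 ?sqr_ge0// ltW// eta0.
have [Ele sumle] := energy_le_initial delta0_gt0 xi0 xi_ge E0 d0 diss.
split.
  have [B HB] := coercive_sublevel_bounded f (E 0%N / delta0) f_coer.
  by exists B => k; apply: HB; exact: le_trans (fE k) (Ele k).
exists (E 0%N / dt) => n; rewrite ler_pdivlMr// mulrC mulr_sumr; exact: sumle.
Qed.

(** With [eta] bounded below the squared velocities are summable, so the
    velocities, and with them the gradients, tend to 0. *)
Lemma gradient_cvg0 {R : realType} {N : nat} {f : 'rV[R]_N -> R}
    {x v : nat -> 'rV[R]_N} {eta : nat -> R} {C eps0 : R} :
  gradient_controlled f x v -> 0 < eps0 ->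
  (forall k, (1 <= k)%N -> eps0 <= eta k) ->
  (forall n, \sum_(0 <= k < n) eta k.+1 * enorm (v k.+1) ^+ 2 <= C) ->
  gradient f (x k) @[k --> \oo] --> (0 : 'rV[R]_N).
Proof.
move=> [M M0 gle] eps0_gt0 eta_ge sumC.
have sqr0 : enorm (v k.+1) ^+ 2 @[k --> \oo] --> (0 : R).
  apply: cvg_series_cvg_0; apply: (bounded_series_cvg _ (C / eps0)) => [k|n].
    exact: sqr_ge0.
  rewrite ler_pdivlMr// mulrC mulr_sumr; apply: le_trans (sumC n).
  by apply: ler_sum => k _; rewrite ler_wpM2r ?sqr_ge0// eta_ge.
have vS0 : enorm (v k.+1) @[k --> \oo] --> (0 : R).
  rewrite -(@sqrtr0 R); under eq_fun do
    rewrite -[enorm _]ger0_norm ?enorm_ge0// -sqrtr_sqr.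
  by apply: continuous_cvg => //; exact: sqrt_continuous.
have v0 : enorm (v k) @[k --> \oo] --> (0 : R).
  by rewrite -(cvg_shiftS (fun k => enorm (v k))).
apply/norm_cvg0P.
apply: (@squeeze_cvgr _ _ _ _ (fun=> 0)
  (fun k => M * (enorm (v k) + enorm (v k.+1)))).
- by apply: nearW => k; rewrite normr_ge0 gle.
- exact: cvg_cst.
- rewrite -[X in _ --> X](mulr0 M) -[X in M * X](addr0 0).
  by apply: cvgM; [exact: cvg_cst|exact: cvgD].
Qed.

(** The weights [omega / k] are those of the harmonic series, so consecutive
    velocities are simultaneously small infinitely often. A first extraction
    makes the gradients tend to 0, a second one makes the iterates converge. *)
Lemma gradient_cvg0_subsequence {R : realType} {N : nat} {f : 'rV[R]_N -> R}
    {x v : nat -> 'rV[R]_N} {eta : nat -> R} {B C omega : R} :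
  continuous (gradient f) -> (forall k, `|x k| <= B) ->
  gradient_controlled f x v -> 0 < omega ->
  (forall k, (1 <= k)%N -> omega / k%:R <= eta k) ->
  (forall n, \sum_(0 <= k < n) eta k.+1 * enorm (v k.+1) ^+ 2 <= C) ->
  exists (s : nat -> nat) (xstar : 'rV[R]_N),
    [/\ {homo s : i j / (i < j)%N >-> (i < j)%N},
        x (s j) @[j --> \oo] --> xstar,
        gradient f (x (s j)) @[j --> \oo] --> (0 : 'rV[R]_N)
      & gradient f xstar = 0].
Proof.
move=> gcont xB [M M0 gle] omega0 eta_ge sumC.
have small j n : exists2 k, (n <= k)%N & `|0 - gradient f (x k)| < j.+1%:R^-1.
  (* Both velocities must be below [e] for [M * (e + e)] to be [1 / (j + 1)]. *)
  pose e : R := j.+1%:R^-1 / (2 * M).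
  have e0 : 0 < e by rewrite divr_gt0 ?invr_gt0// mulr_gt0.
  have [|m| |k nk [ltk ltSk]] := @harmonic_sum_consecutive_small _
      (fun k => enorm (v k.+1) ^+ 2) (C / omega) _ _ (e ^+ 2) n.
  - by move=> k; exact: sqr_ge0.
  - rewrite ler_pdivlMr// mulrC mulr_sumr; apply: le_trans (sumC m).
    apply: ler_sum => i _; rewrite mulrCA mulrC; apply: ler_wpM2r.
      exact: sqr_ge0.
    exact: eta_ge.
  - exact: exprn_gt0.
  exists k.+1; first exact: leqW.
  rewrite sub0r normrN; apply: le_lt_trans (gle _) _.
  have -> : j.+1%:R^-1 = M * (e + e).
    by rewrite /e; field; rewrite gt_eqF//= addrC natr1 pnatr_eq0.
  rewrite ltr_pM2l//.
  by apply: ltrD; rewrite -ltr_sqr ?nnegrE ?enorm_ge0 ?(ltW e0).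
have [s s_incr sg] := increasing_choice
  (fun j k => `|0 - gradient f (x k)| < j.+1%:R^-1) small.
have [t [xstar [t_incr xt]]] :=
  bounded_cvg_subsequence (fun j => x (s j)) B (fun j => xB _).
have gt : gradient f (x (s (t j))) @[j --> \oo] --> gradient f xstar.
  by apply: continuous_cvg => //; exact: gcont.
have gs0 : gradient f (x (s j)) @[j --> \oo] --> (0 : 'rV[R]_N).
  exact: cvg_natSinv_bound.
have t_oo : t j @[j --> \oo] --> \oo.
  apply/cvgnyPge => A; near=> j; apply: (@leq_trans j).
    by near: j; exact: nbhs_infty_ge.
  by elim: (j) => // i IHi; exact: leq_ltn_trans IHi (t_incr _ _ _).
have gt0 : gradient f (x (s (t j))) @[j --> \oo] --> (0 : 'rV[R]_N).
  exact: (cvg_comp _ _ t_oo gs0).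
exists (s \o t), xstar; split => //.
  by move=> i j ij /=; exact/s_incr/t_incr.
exact: (cvg_unique _ gt gt0).
Unshelve. all: by end_near. Qed.

Theorem theorem3p6 (R : realType) (N : nat) (f : 'rV[R]_N -> R)
    (L : 'End('rV[R]_N)) (S dt : R) (eta xi : nat -> R)
    (x v : nat -> 'rV[R]_N) (delta0 eta_max : R)
    (f_min : has_minimizer f)
    (f_coercive : coercive f)
    (f_C1 : continuously_differentiable f)
    (L_psd : positive_semidefinite L)
    (L_bounded : bounded_operator L)
    (S_gt0 : 0 < S)
    (dt_gt0 : 0 < dt)
    (eta_gt0 : forall k : nat, (1 <= k)%N -> 0 < eta k)
    (generated :
      ((forall a b : 'rV[R]_N, 0 < sof_energy f a b) /\
       LLM_SOF f L S dt eta x v xi)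
      \/
      [/\ forall a b : 'rV[R]_N, 0 < vos_energy f a b,
          dt < 1
        & exists y : nat -> 'rV[R]_N, LLM_VOS f dt eta x y v xi])
    (delta0_gt0 : 0 < delta0)
    (eta_max_gt0 : 0 < eta_max)
    (xi_ge : forall k : nat, delta0 <= xi k)
    (eta_le : forall k : nat, eta k.+1 <= eta_max) :
  ((exists2 omega : R, 0 < omega &
      forall k : nat, (1 <= k)%N -> omega / k%:R <= eta k) ->
   exists (s : nat -> nat) (xstar : 'rV[R]_N),
     [/\ {homo s : i j / (i < j)%N >-> (i < j)%N},
         x (s j) @[j --> \oo] --> xstar,
         gradient f (x (s j)) @[j --> \oo] --> (0 : 'rV[R]_N)
       & gradient f xstar = 0])
  /\
  ((exists2 eps0 : R, 0 < eps0 &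
      forall k : nat, (1 <= k)%N -> eps0 <= eta k) ->
   gradient f (x k) @[k --> \oo] --> (0 : 'rV[R]_N)).
Proof.
have xi_ge0 k : 0 <= xi k by rewrite (le_trans _ (xi_ge k))// ltW.
have [xi0 diss ctrl] : [/\ xi 0%N = 1, energy_dissipating dt f eta xi x v
                         & gradient_controlled f x v].
  case: generated => [[E_gt0 sof]|[E_gt0 dt_lt1 [y vos]]].
    split; first by case: sof.
      exact: sof_energy_dissipating sof.
    exact: (sof_gradient_controlled L_psd L_bounded S_gt0 dt_gt0 delta0_gt0
              eta_max_gt0 eta_gt0 xi_ge eta_le sof).
  have dt01 : 0 < dt < 1 by rewrite dt_gt0.
  split; first by case: vos.
    exact: vos_energy_dissipating vos.
  exact: (vos_gradient_controlled dt01 delta0_gt0 eta_max_gt0 eta_gt0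
            xi_ge eta_le vos).
have [[B xB] [C sumC]] := energy_dissipating_bounds
  f_coercive dt_gt0 delta0_gt0 eta_gt0 xi0 xi_ge diss.
split=> [[omega omega0 eta_ge]|[eps0 eps0_gt0 eta_ge]].
  exact: (gradient_cvg0_subsequence f_C1.2 xB ctrl omega0 eta_ge sumC).
exact: (gradient_cvg0 ctrl eps0_gt0 eta_ge sumC).
Qed.
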